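(* For every tabloid $\theta$, $w(\theta)=\mathrm{val}(\theta)$.
   Context: Young diagrams are in English notation. A tabloid of shape $\lambda$ and content $\mu$ (partitions of $n$) is a filling of the Young diagram of $\lambda$ with exactly $\mu_i$ entries equal to $i$ for each $i$, rows weakly increasing from left to right (no column condition). $w(\theta)$ is the number of pairs of cells with entries $i>k$ such that (1) the cell of $i$ is either below the cell of $k$ in the same column or in a column strictly to the left of $k$'s column, and (2) if there is a box immediately to the right of $k$'s cell, filled with $j$, then $i\le j$. The value of an entry $x$ (in a given cell) of $\theta$ is the number of cells containing entries smaller than $x$ that are either in the same column as $x$ and above it, or in the column immediately to the right of $x$'s column and below $x$'s row. $\mathrm{val}(\theta)$ is the sum of the values of all entries of $\theta$. *)

(* Defs.v *)
From mathcomp Require Import all_boot.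

Set Implicit Arguments.
Unset Strict Implicit.
Unset Printing Implicit Defensive.

Definition is_partition (n : nat) (la : seq nat) : bool :=
  [&& sorted geq la, 0 \notin la & sumn la == n].

(* A cell is a pair (row, column), both counted from 0; English notation: row
   indices increase downwards and column indices increase to the right. *)
Definition cell : Type := (nat * nat)%type.

Definition cells (la : seq nat) : seq cell :=
  [seq (r, c) | r <- iota 0 (size la), c <- iota 0 (nth 0 la r)].

(* A filling is the sequence of its rows, so its diagram is [shape t]. *)
Definition entry (t : seq (seq nat)) (x : cell) : nat :=
  nth 0 (nth [::] t x.1) x.2.

Definition right_cell (x : cell) : cell := (x.1, x.2.+1).

(* Entries are positive integers: the entry i.+1 occurs [nth 0 mu i] times,
   where [nth 0 mu i] is the (i+1)-st part of mu (0 beyond the last part). *)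
Definition is_tabloid (la mu : seq nat) (t : seq (seq nat)) : Prop :=
  [/\ shape t = la,
      all (sorted leq) t,
      count_mem 0 (flatten t) = 0
    & forall i : nat, count_mem i.+1 (flatten t) = nth 0 mu i].

(* x is the cell of the larger entry i, y the cell of the smaller entry k. *)
Definition w_pair (t : seq (seq nat)) (x y : cell) : bool :=
  [&& entry t y < entry t x,
      ((x.2 == y.2) && (y.1 < x.1)) || (x.2 < y.2)
    & (right_cell y \in cells (shape t)) ==>
        (entry t x <= entry t (right_cell y))].

Definition w (t : seq (seq nat)) : nat :=
  count (fun p : cell * cell => w_pair t p.1 p.2)
    [seq (x, y) | x <- cells (shape t), y <- cells (shape t)].

Definition cell_value (t : seq (seq nat)) (x : cell) : nat :=
  count (fun y : cell =>
      (entry t y < entry t x) &&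
      (((y.2 == x.2) && (y.1 < x.1)) || ((y.2 == x.2.+1) && (x.1 < y.1))))
    (cells (shape t)).

Definition tabloid_val (t : seq (seq nat)) : nat :=
  \sum_(x <- cells (shape t)) cell_value t x.

(* Main.v *)
Require Import Defs.
From mathcomp Require Import all_boot.

(** Fix the cell x = (r, c) of the larger entry i. A row contains at most one
    cell y whose entry is < i and whose right neighbour is absent or >= i: the
    last cell of that row with an entry < i. That cell lies in column >= d iff
    column d of the row holds an entry < i. Taking d = c for the rows above r
    and d = c + 1 for the other rows, the pairs counted by w at x are in
    bijection, row by row, with the cells counted by the value of x (row r
    contributes nothing, being weakly increasing). *)

Lemma count_allpairs_dep (S T R : Type) (f : S -> T -> R) (p : pred R)
    (s : seq S) (u : S -> seq T) :
  count p [seq f x y | x <- s, y <- u x]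
  = \sum_(x <- s) count (fun y => p (f x y)) (u x).
Proof.
rewrite count_flatten sumnE !big_map; apply: eq_bigr => x _.
by rewrite count_map.
Qed.

Lemma mem_cells (la : seq nat) (r c : nat) :
  ((r, c) \in cells la) = (c < nth 0 la r).
Proof.
apply/allpairsPdep/idP => [[r' [c' []]]|lt_c].
  by rewrite !mem_iota => _ lt_c [-> ->].
exists r, c; split => //; rewrite mem_iota //=.
(* A row index past the end has default length 0, so [c < nth 0 la r] already bounds [r]. *)
by rewrite ltnNge; apply: contraL lt_c => /(nth_default 0) ->.
Qed.

(** Entries [< i] form a prefix of the sorted row, and only the end of that prefix can be
    counted. *)
Lemma count_last_lt (i d : nat) (s : seq nat) : sorted leq s ->
  count (fun c => [&& nth 0 s c < i, d <= c
                    & (c.+1 < size s) ==> (i <= nth 0 s c.+1)])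
    (iota 0 (size s))
  = (d < size s) && (nth 0 s d < i).
Proof.
elim: s d => [|a s IHs] d //= a_s; have s_sorted := path_sorted a_s.
rewrite (iotaDl 1 0) count_map; case: d => [|d] /=.
  (* For [d = 0]: if the tail's head is [< i], the tail contributes 1 and [a] is not last; otherwise
     only [a] can count. *)
  have /= -> := IHs 0 s_sorted.
  case: s a_s {IHs s_sorted} => [|b s] /=; first by rewrite andbT addn0.
  case/andP=> le_ab _; case: (ltnP b i) => [lt_bi|_].
    by rewrite (leq_ltn_trans le_ab lt_bi).
  by rewrite andbT addn0.
by rewrite andbF; apply: (IHs d s_sorted).
Qed.

(** Puts the value side, row by row, in the closed form of [count_last_lt]. *)
Lemma count_eq_lt (i d : nat) (s : seq nat) :
  count (fun c => (nth 0 s c < i) && (c == d)) (iota 0 (size s))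
  = (d < size s) && (nth 0 s d < i).
Proof.
rewrite (eq_count (a2 := fun c => (nth 0 s d < i) && (c == d))); last first.
  by move=> c; case: eqP => [->|]; rewrite ?andbF.
case: (nth 0 s d < i); last by rewrite count_pred0 andbF.
by rewrite (count_uniq_mem _ (iota_uniq _ _)) mem_iota andbT.
Qed.

Lemma count_w_pair (t : seq (seq nat)) (x : cell) :
    all (sorted leq) t -> x \in cells (shape t) ->
  count (w_pair t x) (cells (shape t)) = cell_value t x.
Proof.
case: x => r c t_sorted; rewrite mem_cells nth_shape => lt_c.
rewrite /cell_value !count_allpairs_dep; apply: eq_bigr => r' _.
have row_sorted q : sorted leq (nth [::] t q).
  have [/(all_nthP [::] t_sorted) //|/(nth_default [::]) -> //] := ltnP q (size t).
rewrite nth_shape /w_pair /entry /=.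
under eq_count => c' do rewrite mem_cells nth_shape.
set i := nth 0 (nth [::] t r) c.
set d := if r' < r then c else c.+1.
(* Above row [r], [c = c'] or [c < c'] merges into [c <= c']; elsewhere only [c < c'] remains. *)
rewrite (eq_count (a2 := fun c' => [&& nth 0 (nth [::] t r') c' < i, d <= c'
    & (c'.+1 < size (nth [::] t r')) ==> (i <= nth 0 (nth [::] t r') c'.+1)]));
  last first.
  by move=> c'; rewrite /d; case: (r' < r); rewrite ?andbT ?andbF -?leq_eqVlt.
rewrite count_last_lt //; case: (ltngtP r' r) @d => [_|_|->] d; rewrite /d.
- under eq_count => c' do rewrite andbT andbF orbF.
  by rewrite count_eq_lt.
- under eq_count => c' do rewrite andbF andbT orFb.
  by rewrite count_eq_lt.
under eq_count => c' do rewrite !andbF.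
rewrite count_pred0; case: ltnP => //= lt_c1.
suff: i <= nth 0 (nth [::] t r) c.+1 by rewrite leqNgt => /negbTE ->.
by apply: (sorted_leq_nth leq_trans leqnn) => //; apply: row_sorted.
Qed.

Theorem theorem4p6 (n : nat) (la mu : seq nat)
    (hla : is_partition n la) (hmu : is_partition n mu)
    (t : seq (seq nat)) (ht : is_tabloid la mu t) :
  w t = tabloid_val t.
Proof.
have [_ t_sorted _ _] := ht.
rewrite /w count_allpairs_dep /tabloid_val; apply: eq_big_seq => x x_t.
exact: count_w_pair.
Qed.
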